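(* For any integer $s\geq 3$, there exists some $\varepsilon>0$ (depending only on $s$) such that for any positive integer $t$ there is a constant $C_{s,t}$ depending only on $s$ and $t$ such that for all positive integers $n$, $$\mathrm{ex}(n,K_{s,t}^{(3)})\leq C_{s,t}\, n^{3-\frac{1}{s-1}-\varepsilon}.$$
   Context: For an $r$-uniform hypergraph $H$, $\mathrm{ex}(n,H)$ denotes the largest number of edges in an $r$-uniform hypergraph on $n$ vertices containing no copy of $H$ (as a not necessarily induced subhypergraph). For positive integers $s,t$, $K_{s,t}^{(3)}$ denotes the $3$-uniform hypergraph whose vertex set is the union of pairwise disjoint sets $X,Y_1,\dots,Y_t$ with $|X|=s$ and $|Y_1|=\dots=|Y_t|=2$, and whose edge set is $\{\{x\}\cup Y_i : x\in X,\ 1\leq i\leq t\}$. *)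

(* Defs.v *)
From HB Require Import structures.
From mathcomp Require Import all_boot all_order all_algebra.
From mathcomp Require Import reals exp.
Set Implicit Arguments.
Unset Strict Implicit.
Unset Printing Implicit Defensive.

(* A hypergraph is given by its vertex type and its set of edges. *)
Definition uniform (r : nat) (V : finType) (H : {set {set V}}) : bool :=
  [forall e in H, #|e| == r].

(* G contains a (not necessarily induced) copy of H. *)
Definition contains_copy (V W : finType) (H : {set {set V}})
    (G : {set {set W}}) : bool :=
  [exists f : {ffun V -> W}, injectiveb f && [forall e in H, f @: e \in G]].

(* Hypergraphs on n vertices are taken, up to isomorphism, on 'I_n. *)
Definition extremal (r n : nat) (V : finType) (H : {set {set V}}) : nat :=
  \max_(G : {set {set 'I_n}} | uniform r G && ~~ contains_copy H G) #|G|.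

(* inl 'I_s is X; the two points inr (i, _) form the pair Y_i. *)
Definition Kvertex (s t : nat) : finType := ('I_s + 'I_t * bool)%type.

Definition Kpart (s t : nat) (i : 'I_t) : {set Kvertex s t} :=
  [set inr (i, b) | b : bool].

Definition K3 (s t : nat) : {set {set Kvertex s t}} :=
  [set (inl x : Kvertex s t) |: Kpart s i | x : 'I_s, i : 'I_t].

(* Main.v *)
(* View the edges as ordered triples (x, b, c).  For distinct x_1, ..., x_s the
   common link contains no matching of size t, so it has a vertex cover T with at
   most 2t elements.  Hence in at least half of the stars (x_1, ..., x_s; b, c),
   up to swapping b and c, the vertex b lies in T.  There are only 2t n^s pairs
   ((x_1, ..., x_s), b) of this kind, which forces the link of a typical b to look
   like a disjoint union of complete bipartite graphs with parts of size about
   D = n^(1 - 1/(s-1)).  Peeling these off greedily leaves a dense subhypergraph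
   in which few pairs (b, S), with S an s-tuple in either of the other two classes,
   have a common neighbour.  Doing this first for s-tuples in class 1 and then for
   s-tuples in the class of b, one gets two classes whose pairs with s-tuples of the
   third one are both scarce; but by the cover property these pairs account, up to
   a factor 2t, for all stars over the third class, and there are too many of them.
   The argument needs all pair degrees to be at most D n^O(eps): this holds on a
   layer of edges whose maximal pair degree is constant up to a factor n^eps, for
   otherwise the largest pair degree would produce too many stars. *)
Require Import Defs.
From HB Require Import structures.
From mathcomp Require Import all_boot all_order all_algebra.
From mathcomp Require Import reals exp.
From mathcomp Require Import ring lra.
Import Order.TTheory GRing.Theory Num.Theory.
Set Implicit Arguments.
Unset Strict Implicit.
Unset Printing Implicit Defensive.
Local Open Scope ring_scope.

Ltac nonneg := repeat first
  [ done | by apply: ltW | apply: exprn_ge0 | apply: divr_ge0 | apply: mulr_ge0 | apply: addr_ge0 ].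

(** * Counting tuples *)

Section Counting.
Variables (R : realFieldType) (V : finType) (s : nat).
Implicit Types (A : {set V}).

Lemma ler_indicator (b1 b2 : bool) : (b1 -> b2) -> b1%:R <= b2%:R :> R.
Proof. by case: b1 b2 => [] [] // /(_ isT). Qed.

Lemma sum_indicator (T : finType) (P : pred T) :
  \sum_x (P x)%:R = #|[set x | P x]|%:R :> R.
Proof.
by rewrite -natr_sum -sum1dep_card [in RHS]big_mkcond; congr (_%:R); apply: eq_bigr => x _; case: (P x).
Qed.

Lemma indicator_forall (T : finType) (P : pred T) :
  [forall i, P i]%:R = \prod_i (P i)%:R :> R.
Proof.
case: (boolP [forall i, P i]) => [/forallP h | /forallPn [i hi]].
  by rewrite big1 // => i _; rewrite h.
by rewrite (bigD1 i) //= (negbTE hi) mul0r.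
Qed.

Lemma sum_indicator_forall (P : 'I_s -> pred V) :
  \sum_(S : {ffun 'I_s -> V}) [forall i, P i (S i)]%:R
  = \prod_i \sum_x (P i x)%:R :> R.
Proof. by rewrite bigA_distr_bigA; apply: eq_bigr => S _; rewrite indicator_forall. Qed.

Lemma sum_ffun_on A :
  \sum_(S : {ffun 'I_s -> V}) [forall i, S i \in A]%:R = #|A|%:R ^+ s :> R.
Proof.
rewrite (sum_indicator_forall (fun _ x => x \in A)).
rewrite (eq_bigr (fun _ => #|A|%:R)) => [|i _]; first by rewrite prodr_const card_ord.
by rewrite sum_indicator cardsE.
Qed.

(** Relax the condition at [i0] to [x == x0] alone; the other s - 1 coordinates range freely over
    [A]. *)
Lemma sum_ffun_on_fix (i0 : 'I_s) (x0 : V) A :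
  \sum_(S : {ffun 'I_s -> V}) ((S i0 == x0) && [forall i, S i \in A])%:R
  <= #|A|%:R ^+ s.-1 :> R.
Proof.
pose P i x := if i == i0 then x == x0 else x \in A.
apply: (@le_trans _ _ (\sum_(S : {ffun 'I_s -> V}) [forall i, P i (S i)]%:R)).
  apply: ler_sum => S _; apply: ler_indicator => /andP [h /forallP hA].
  by apply/forallP => i; rewrite /P; case: eqP => [->|_].
rewrite sum_indicator_forall (bigD1 i0) //= /P eqxx.
rewrite sum_indicator (_ : [set x | x == x0] = [set x0]); last by apply/setP => x; rewrite !inE.
rewrite cards1 mul1r (eq_bigr (fun _ => #|A|%:R)) => [|i /negbTE ->].
  by rewrite prodr_const cardC1 card_ord.
by rewrite sum_indicator cardsE.
Qed.

Lemma sum_ffun_on_inj A :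
  \sum_(S : {ffun 'I_s -> V} | injectiveb S) [forall i, S i \in A]%:R
  = (#|A| ^_ s)%:R :> R.
Proof.
have := card_inj_ffuns_on 'I_s (mem A); rewrite card_ord => <-.
rewrite -sum1dep_card natr_sum big_mkcond [RHS]big_mkcond /=.
apply: eq_bigr => S _; rewrite andbC.
have -> : (S \in ffun_on (mem A)) = [forall i, S i \in A] by apply/ffun_onP/forallP.
by case: (injectiveb S); case: [forall i, _].
Qed.

(* A truncation that replaces Jensen's inequality in the star count. *)
Lemma ffact_lower (d : nat) (th : R) : (0 < s)%N -> 2 * s%:R <= th ->
  (d%:R - th) * (th / 2) ^+ s.-1 <= (d ^_ s)%:R.
Proof.
move=> s0 hs.
have th0 : 0 <= th by apply: le_trans hs; rewrite mulr_ge0.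
have p0 k : 0 <= (th / 2) ^+ k by rewrite exprn_ge0 // divr_ge0.
(* Below [th] the left side is nonpositive. Otherwise keep the first factor d; each of the other s -
   1 factors is at least th - s, hence at least th / 2. *)
have [hd|hd] := ltP d%:R th.
  apply: (@le_trans _ _ 0) => //; apply: mulr_le0_ge0 => //; lra.
apply: (@le_trans _ _ (d%:R * (th / 2) ^+ s.-1)).
  by apply: ler_wpM2r => //; lra.
suff: forall k, (k < s)%N -> d%:R * (th / 2) ^+ k <= (d ^_ k.+1)%:R.
  by move=> /(_ s.-1); rewrite prednK // leqnn => /(_ isT).
elim=> [_|k IH ks]; first by rewrite expr0 mulr1 ffactn1.
rewrite ffactnSr natrM exprSr mulrA.
have kd : (k.+1 <= d)%N.
  rewrite -(ler_nat R); apply: le_trans hd.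
  have : (k.+1%:R : R) <= s%:R by rewrite ler_nat ltnW.
  have : 0 <= s%:R :> R by []. lra.
apply: ler_pM => //; first by rewrite mulr_ge0.
- by lra.
- by apply: IH; apply: ltnW.
- rewrite natrB //.
  have : (k.+1%:R : R) <= s%:R by rewrite ler_nat ltnW.
  lra.
Qed.

End Counting.

(** * Stars and covers *)

Section Triples.
Variables (R : realFieldType) (V : finType) (s : nat).
Hypothesis s_gt0 : (0 < s)%N.
Implicit Types (G H : V -> V -> V -> bool) (S : {ffun 'I_s -> V}).
Implicit Types (T : {ffun 'I_s -> V} -> {set V}) (D : R).
Local Notation tup := {ffun 'I_s -> V}.
Local Notation n := (#|V|%:R : R).

Definition swap G x c b := G x b c.

Definition edges G : R := \sum_x \sum_b \sum_c (G x b c)%:R.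

Definition adj G S b c := [forall i, G (S i) b c].

Definition bounded D G := forall u v, [/\ \sum_w (G w u v)%:R <= D,
  \sum_w (G u w v)%:R <= D & \sum_w (G u v w)%:R <= D].

Definition stars T G : R :=
  \sum_(S : tup | injectiveb S) \sum_(b in T S) \sum_c (adj G S b c)%:R.

(** Restricted to injective [S]: a tuple with repetitions has fewer than s vertices and yields no
    copy of the forbidden hypergraph. *)
Definition covers T G := forall S b c, injective S -> adj G S b c ->
  (b \in T S) || (c \in T S).

(* The s-tuples of [shadow G] live in the first class; [shadow (rev G)] is the
   analogous count for s-tuples in the third class. *)
Definition shadow G : R := \sum_b \sum_(S : tup) [exists c, adj G S b c]%:R.

Definition subtriple G H := forall x b c, G x b c -> H x b c.

Lemma subtriple_adj G H S b c : subtriple G H -> adj G S b c -> adj H S b c.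
Proof. by move=> sub /forallP h; apply/forallP => i; apply/sub/h. Qed.

Lemma sub_bounded D G H : subtriple G H -> bounded D H -> bounded D G.
Proof.
move=> sub bH u v; have [h1 h2 h3] := bH u v.
by split; [apply: le_trans h1|apply: le_trans h2|apply: le_trans h3];
  apply: ler_sum => w _; apply/ler_indicator/sub.
Qed.

Lemma sub_covers T G H : subtriple G H -> covers T H -> covers T G.
Proof. by move=> sub cH S b c injS /(subtriple_adj sub); apply: cH. Qed.

Lemma sub_shadow G H : subtriple G H -> shadow G <= shadow H.
Proof.
move=> sub; apply: ler_sum => b _; apply: ler_sum => S _; apply: ler_indicator.
by case/existsP=> c /(subtriple_adj sub) h; apply/existsP; exists c.
Qed.

Lemma bounded_swap D G : bounded D G -> bounded D (swap G).
Proof.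
move=> bG u v; have [h1 h2 h3] := bG u v; have [g1 g2 g3] := bG v u.
by split; rewrite /swap.
Qed.

Lemma edges_ge0 G : 0 <= edges G.
Proof. by do 3!apply: sumr_ge0 => ? _. Qed.

Lemma sum_const_le (I : finType) (f : I -> R) (M : R) :
  (forall i, f i <= M) -> \sum_i f i <= #|I|%:R * M.
Proof.
move=> h; apply: (@le_trans _ _ (\sum_(i : I) M)); first exact: ler_sum.
by rewrite sumr_const mulr_natl.
Qed.

Lemma sum_set_const_le (I : finType) (A : {set I}) (f : I -> R) (M : R) :
  (forall i, i \in A -> f i <= M) -> \sum_(i in A) f i <= #|A|%:R * M.
Proof.
move=> h; apply: (@le_trans _ _ (\sum_(i in A) M)); first exact: ler_sum.
by rewrite sumr_const mulr_natl.
Qed.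

Lemma edges_le D G : bounded D G -> edges G <= n ^+ 2 * D.
Proof.
move=> bG; rewrite expr2 -mulrA; apply: sum_const_le => x.
by apply: sum_const_le => b; have [] := bG x b.
Qed.

Lemma sum_adj_le D G S b : bounded D G -> \sum_c (adj G S b c)%:R <= D.
Proof.
move=> bG; pose i0 := Ordinal s_gt0; have [_ _] := bG (S i0) b.
apply: le_trans; apply: ler_sum => c _; apply: ler_indicator.
by move=> /forallP /(_ i0).
Qed.

Lemma adjE G S b c : adj G S b c = [forall i, S i \in [set x | G x b c]].
Proof. by apply: eq_forallb => i; rewrite inE. Qed.

(** Apply [ffact_lower] to the degree of each pair (b, c). Only pairs in [Q] carry edges, so
    subtracting [th] once per such pair costs at most half of the edges. [Q] is trivial in the dense
    case and consists of the pairs of large degree in the layer argument. *)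
Lemma stars_lower (Q : rel V) (th : R) G :
  (forall x b c, G x b c -> Q b c) ->
  (\sum_b \sum_c (Q b c)%:R) * th <= edges G / 2 -> 2 * s%:R <= th ->
  edges G / 2 * (th / 2) ^+ s.-1 <= stars (fun=> setT) G.
Proof.
move=> GQ hQ hs.
have -> : stars (fun=> setT) G = \sum_b \sum_c (#|[set x | G x b c]| ^_ s)%:R.
  rewrite /stars exchange_big; rewrite big_mkcond; apply: eq_bigr => b _.
  rewrite inE exchange_big; apply: eq_bigr => c _.
  by rewrite -sum_ffun_on_inj; apply: eq_bigr => S _; rewrite adjE.
have p0 : 0 <= (th / 2) ^+ s.-1.
  by rewrite exprn_ge0 // divr_ge0 //; apply: le_trans hs; rewrite mulr_ge0.
apply: (@le_trans _ _
   (\sum_b \sum_c (#|[set x | G x b c]|%:R - (Q b c)%:R * th) * (th / 2) ^+ s.-1)).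
  under eq_bigr do rewrite -mulr_suml.
  rewrite -mulr_suml; apply: ler_wpM2r => //.
  under eq_bigr do rewrite sumrB -mulr_suml.
  rewrite sumrB -mulr_suml.
  have -> : \sum_b \sum_c #|[set x | G x b c]|%:R = edges G.
    rewrite /edges [RHS]exchange_big; apply: eq_bigr => b _.
    by rewrite [RHS]exchange_big; apply: eq_bigr => c _; rewrite sum_indicator.
  lra.
apply: ler_sum => b _; apply: ler_sum => c _.
case: (boolP (Q b c)) => [_|nQ]; first by rewrite mul1r; apply: ffact_lower.
have -> : [set x | G x b c] = set0.
  by apply/setP => x; rewrite !inE; apply/negbTE; apply: contra nQ; apply: GQ.
by rewrite cards0 mul0r subrr mul0r.
Qed.

(** Every star has b or c in [T S]; in the second case exchanging the last two classes brings it to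
    the first form. *)
Lemma stars_split T G : covers T G ->
  stars (fun=> setT) G <= stars T G + stars T (swap G).
Proof.
move=> cT; rewrite /stars -big_split; apply: ler_sum => S /injectiveP injS /=.
rewrite big_mkcond [X in X + _]big_mkcond /=.
rewrite [X in _ <= _ + X]big_mkcond /=.
rewrite [X in _ <= _ + X](_ : _ =
  \sum_b \sum_c (if c \in T S then (adj G S b c)%:R else 0)); last first.
  rewrite exchange_big; apply: eq_bigr => c _.
  by case: ifP => // _; rewrite big1.
rewrite -big_split; apply: ler_sum => b _; rewrite inE /=.
rewrite [X in X + _](_ : _ = \sum_c (if b \in T S then (adj G S b c)%:R else 0)); last first.
  by case: ifP => // _; rewrite big1.
rewrite -big_split; apply: ler_sum => c _ /=.
have := cT S b c injS; case: (adj G S b c) => [/(_ isT) | _].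
  by case: (b \in T S); case: (c \in T S) => //= _; lra.
by case: ifP; case: ifP; rewrite /= addr0.
Qed.

Lemma stars_le T G (m D : R) : 0 <= D -> (forall S, #|T S|%:R <= m) ->
  bounded D G -> stars T G <= n ^+ s * (m * D).
Proof.
move=> D0 hm bG.
apply: (@le_trans _ _ (\sum_(S : tup) m * D)).
  rewrite [leLHS]big_mkcond; apply: ler_sum => S _.
  have Tm : #|T S|%:R * D <= m * D by apply: ler_wpM2r.
  case: ifP => _; last by apply: le_trans Tm; rewrite mulr_ge0.
  by apply: le_trans Tm; apply: sum_set_const_le => b _; apply: sum_adj_le.
by rewrite sumr_const cardT -cardE card_ffun card_ord -natrX mulr_natl.
Qed.

(** * Peeling off bicliques *)

Definition rev G c b x := G x b c.

(** Each of the at most m vertices b of [T S] can only use those c that have some common neighbour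
    with [S], and [shadow (swap G)] counts exactly these pairs (c, S). *)
Lemma stars_shadow T G (m : R) : (forall S, #|T S|%:R <= m) ->
  stars T G <= m * shadow (swap G).
Proof.
move=> hm; rewrite /shadow exchange_big mulr_sumr /stars big_mkcond.
apply: ler_sum => S _.
set sh := \sum_c _; have sh0 : 0 <= sh by apply: sumr_ge0.
have Tm : #|T S|%:R * sh <= m * sh by apply: ler_wpM2r.
case: ifP => _; last by apply: le_trans Tm; rewrite mulr_ge0.
apply: le_trans Tm; apply: sum_set_const_le => b _.
apply: ler_sum => c _; apply: ler_indicator => h.
by apply/existsP; exists b.
Qed.

Lemma stars_le_shadow T G (m : R) : (forall S, #|T S|%:R <= m) -> covers T G ->
  stars (fun=> setT) G <= m * (shadow G + shadow (swap G)).
Proof.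
move=> hm cT; apply: (le_trans (stars_split cT)).
rewrite mulrDr addrC; apply: lerD; last exact: stars_shadow.
exact: (@stars_shadow T (swap G)).
Qed.

Definition mates G (thr : R) x0 b : {set V} :=
  [set x | thr <= \sum_c (G x0 b c && G x b c)%:R].

(* Averaging the codegrees over the pairs (S, b) with b in T S: many of them have
   codegree at least thr, and then all S i are mates of S 0 at b. *)
Lemma exists_rich_vertex T G (m D thr k : R) : 0 <= D -> 0 <= thr -> 0 <= k ->
  (forall S, #|T S|%:R <= m) -> bounded D G ->
  n ^+ s * (m * thr) + n ^+ 2 * (D * k ^+ s.-1) < stars T G ->
  exists x0, exists b, k < #|mates G thr x0 b|%:R.
Proof.
move=> D0 thr0 k0 hm bG hst.
case: (boolP [exists x0, exists b, k < #|mates G thr x0 b|%:R]) => [/existsP [x0] /existsP [b] h|].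
  by exists x0, b.
rewrite negb_exists => /forallP hno; exfalso; move: hst; rewrite ltNge => /negP; apply.
pose i0 := Ordinal s_gt0.
pose rich (S : tup) b := thr <= \sum_c (adj G S b c)%:R.
(* A pair (S, b) that is not rich lies in fewer than [thr] stars, a rich one in at most [D]. *)
apply: (@le_trans _ _ (\sum_(S : tup) (m * thr + D * \sum_b (rich S b)%:R))).
  rewrite /stars big_mkcond; apply: ler_sum => S _.
  have r0 : 0 <= D * \sum_b (rich S b)%:R by rewrite mulr_ge0 // sumr_ge0.
  have Tm : #|T S|%:R * thr <= m * thr by apply: ler_wpM2r.
  have m0 : 0 <= m * thr by apply: le_trans Tm; rewrite mulr_ge0.
  case: ifP => _; last by rewrite addr_ge0.
  apply: (@le_trans _ _ (\sum_(b in T S) (thr + D * (rich S b)%:R))).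
    apply: ler_sum => b _; rewrite /rich; case: (leP thr) => h.
      by rewrite mulr1; apply: (le_trans (sum_adj_le S b bG)); rewrite lerDr.
    by rewrite mulr0 addr0 ltW.
  rewrite big_split /=; apply: lerD.
    by apply: le_trans Tm; apply: sum_set_const_le.
  rewrite -mulr_sumr; apply: ler_wpM2l => //.
  by rewrite [leLHS]big_mkcond; apply: ler_sum => b _; case: ifP.
rewrite big_split /=; apply: lerD.
  by rewrite sumr_const cardT -cardE card_ffun card_ord -natrX mulr_natl.
rewrite -mulr_sumr mulrCA; apply: ler_wpM2l => //.
rewrite exchange_big expr2 -mulrA; apply: sum_const_le => b.
(* Group the rich tuples at b by their entry x0 at [i0]: the other s - 1 entries are mates of x0, of
   which there are at most k. *)
apply: (@le_trans _ _ (\sum_x0 #|mates G thr x0 b|%:R ^+ s.-1)); last first.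
  apply: sum_const_le => x0; apply: lerXn2r; rewrite ?nnegrE //.
  by have := hno x0; rewrite negb_exists => /forallP /(_ b); rewrite -leNgt.
apply: (@le_trans _ _ (\sum_x0 \sum_(S : tup)
   ((S i0 == x0) && [forall i, S i \in mates G thr x0 b])%:R)); last first.
  by apply: ler_sum => x0 _; apply: sum_ffun_on_fix.
rewrite exchange_big; apply: ler_sum => S _ /=.
rewrite (bigD1 (S i0)) //= eqxx /=.
apply: (@le_trans _ _ ([forall i, S i \in mates G thr (S i0) b]%:R)); last first.
  by rewrite lerDl sumr_ge0.
apply: ler_indicator => h; apply/forallP => i; rewrite inE.
apply: (le_trans h); apply: ler_sum => c _; apply: ler_indicator.
by move=> /forallP hc; rewrite !hc.
Qed.

Section Peel.
Variables (H : V -> V -> V -> bool) (D thr : R) (x0 b0 : V).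
Hypotheses (bH : bounded D H) (D0 : 0 <= D) (thr_gt0 : 0 < thr).
Let X := mates H thr x0 b0.
Let Y := [set c | H x0 b0 c].

(* Removing all edges at b0 that meet X or Y, and not just those inside X * Y, keeps
   the peeled bicliques disjoint on both sides. *)
Definition peel_off x b c := H x b c && [&& b == b0, x \in X & c \in Y].
Definition peel_rest x b c := H x b c && ~~ ((b == b0) && ((x \in X) || (c \in Y))).
(** The clustered subhypergraph is assembled by gluing the peeled pieces back together, the last
    piece first. *)
Definition glue G x b c := G x b c || peel_off x b c.

Lemma card_Y : #|Y|%:R <= D.
Proof. by have [_ _] := bH x0 b0; rewrite sum_indicator. Qed.

Lemma edges_peel_off : #|X|%:R * thr <= edges peel_off.
Proof.
apply: (@le_trans _ _ (\sum_x (x \in X)%:R * thr)).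
  by rewrite -mulr_suml sum_indicator cardsE.
apply: ler_sum => x _; rewrite (bigD1 b0) //=.
rewrite -[leLHS]addr0; apply: lerD; last by do 2!apply: sumr_ge0 => ? _.
rewrite /peel_off; case: (boolP (x \in X)) => hx; last first.
  by rewrite mul0r sumr_ge0.
rewrite mul1r eqxx /=; move: hx; rewrite inE => /le_trans; apply.
by apply: ler_sum => c _; apply: ler_indicator; rewrite inE andbC.
Qed.

(** Count the pairs (c, x) with c in [Y] and x adjacent to (b0, c): at most D * D of them, while
    each x in [X] occurs at least [thr] times. *)
Lemma card_X : #|X|%:R <= D ^+ 2 / thr.
Proof.
rewrite ler_pdivlMr //.
apply: (@le_trans _ _ (\sum_x (x \in X)%:R * thr)).
  by rewrite -mulr_suml sum_indicator cardsE.
apply: (@le_trans _ _ (\sum_x \sum_c (H x0 b0 c && H x b0 c)%:R)).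
  apply: ler_sum => x _; case: (boolP (x \in X)) => hx.
    by rewrite mul1r; move: hx; rewrite inE.
  by rewrite mul0r sumr_ge0.
rewrite exchange_big /=.
apply: (@le_trans _ _ (\sum_c (c \in Y)%:R * D)).
  apply: ler_sum => c _; rewrite inE; case: (H x0 b0 c) => /=.
    by rewrite mul1r; have [] := bH b0 c.
  by rewrite big1 // mul0r.
rewrite -mulr_suml expr2; apply: ler_wpM2r => //.
by rewrite sum_indicator cardsE card_Y.
Qed.

Lemma peel_rest_sub : subtriple peel_rest H.
Proof. by move=> x b c /andP []. Qed.

Lemma glue_sub G : subtriple G peel_rest -> subtriple (glue G) H.
Proof. by move=> sub x b c /orP [/sub/andP []|/andP []]. Qed.

Lemma edges_glue G : subtriple G peel_rest ->
  edges (glue G) = edges G + edges peel_off.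
Proof.
move=> sub; rewrite /edges -big_split; apply: eq_bigr => x _.
rewrite -big_split; apply: eq_bigr => b _.
rewrite -big_split; apply: eq_bigr => c _ /=.
rewrite /glue; case: (boolP (G x b c)) => [/sub/andP [_]|_] /=; last by rewrite add0r.
rewrite /peel_off negb_and negb_or.
by case: (b == b0); case: (x \in X); case: (c \in Y); rewrite ?andbF //= addr0.
Qed.

Lemma edges_peel : edges peel_rest + edges peel_off <= edges H.
Proof.
rewrite -edges_glue //; do 3!(apply: ler_sum => ? _); apply: ler_indicator.
exact: glue_sub.
Qed.

(** Let c be a common neighbour of (b0, S). If c lies in [Y], no edge of [G] is involved and [S]
    runs inside [X], which gives at most |X|^s new pairs. Otherwise every edge of the star comes
    from [G]. At the other vertices b nothing changes. *)
Lemma shadow_glue G : subtriple G peel_rest ->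
  shadow (glue G) <= shadow G + #|X|%:R ^+ s.
Proof.
move=> sub.
apply: (@le_trans _ _ (shadow G + \sum_b (b == b0)%:R * #|X|%:R ^+ s)); last first.
  by rewrite lerD2l -mulr_suml sum_indicator (_ : [set b | b == b0] = [set b0])
      ?cards1 ?mul1r //; apply/setP => x; rewrite !inE.
rewrite -big_split; apply: ler_sum => b _; rewrite -sum_ffun_on mulr_sumr.
rewrite -big_split; apply: ler_sum => S _ /=; rewrite -natrM mulnb -natrD ler_nat.
case: existsP => // - [c /forallP h].
case: (boolP ((b == b0) && (c \in Y))) => hbc.
  rewrite (andP hbc).1 (_ : [forall i, S i \in X] = true) ?addn1 //.
  apply/forallP => i; have /orP [/sub/andP [_]|/andP [_ /and3P [] //]] := h i.
  by case/andP: hbc => -> ->; rewrite orbT.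
rewrite (_ : [exists _, _] = true) //.
apply/existsP; exists c; apply/forallP => i.
have /orP [//|/andP [_ /and3P [hb _ hc]]] := h i.
by rewrite hb hc in hbc.
Qed.

(** The argument of [shadow_glue] with [X] and [Y] exchanged; this is why edges meeting either side
    were removed. *)
Lemma shadow_rev_glue G : subtriple G peel_rest ->
  shadow (rev (glue G)) <= shadow (rev G) + #|Y|%:R ^+ s.
Proof.
move=> sub.
apply: (@le_trans _ _ (shadow (rev G) + \sum_b (b == b0)%:R * #|Y|%:R ^+ s)); last first.
  by rewrite lerD2l -mulr_suml sum_indicator (_ : [set b | b == b0] = [set b0])
      ?cards1 ?mul1r //; apply/setP => x; rewrite !inE.
rewrite -big_split; apply: ler_sum => b _; rewrite -sum_ffun_on mulr_sumr.
rewrite -big_split; apply: ler_sum => S _ /=; rewrite -natrM mulnb -natrD ler_nat.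
case: existsP => // - [x /forallP h].
case: (boolP ((b == b0) && (x \in X))) => hbx.
  rewrite (andP hbx).1 (_ : [forall i, S i \in Y] = true) ?addn1 //.
  apply/forallP => i; have /orP [/sub/andP [_]|/andP [_ /and3P [] //]] := h i.
  by case/andP: hbx => -> ->.
rewrite (_ : [exists _, _] = true) //.
apply/existsP; exists x; apply/forallP => i.
have /orP [//|/andP [_ /and3P [hb hx _]]] := h i.
by rewrite hb hx in hbx.
Qed.

Lemma sum_adj_tuple_le b c : \sum_(S : tup) (adj H S b c)%:R <= D ^+ s.
Proof.
under eq_bigr do rewrite adjE.
rewrite sum_ffun_on; apply: lerXn2r; rewrite ?nnegrE // -sum_indicator.
by have [] := bH b c.
Qed.

Lemma sum_adj_tuple_fix_le x b c (i : 'I_s) :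
  \sum_(S : tup) ((S i == x) && adj H S b c)%:R <= (H x b c)%:R * D ^+ s.-1.
Proof.
case: (boolP (H x b c)) => h; last first.
  rewrite mul0r big1 // => S _; case: eqP => //= e; case: (boolP (adj _ _ _ _)) => //.
  by move=> /forallP /(_ i); rewrite e (negbTE h).
under eq_bigr do rewrite adjE.
rewrite mul1r; apply: (le_trans (sum_ffun_on_fix _ _ _ _)).
apply: lerXn2r; rewrite ?nnegrE // -sum_indicator.
by have [] := bH b c.
Qed.

(** A lost star has middle vertex b0 and either c in [Y] or some S i in [X]. The first case gives
    |Y| D^s stars; the second gives s choices of i, |X| of x, D of c, and D^(s-1) for the other
    entries. *)
Lemma stars_peel T :
  stars T H <= stars T peel_rest + (D ^+ s.+1 + s%:R * (D ^+ 2 / thr * D ^+ s)).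
Proof.
pose f (S : tup) (c : V) : R := (adj H S b0 c && (c \in Y))%:R +
  \sum_i \sum_(x in X) ((S i == x) && adj H S b0 c)%:R.
have f0 S c : 0 <= f S c by rewrite addr_ge0 //; do 2!apply: sumr_ge0 => ? _.
apply: (@le_trans _ _ (stars T peel_rest + \sum_(S : tup) \sum_c f S c)).
  rewrite /stars big_mkcond [X in X + _]big_mkcond -big_split /=.
  apply: ler_sum => S _.
  case: ifP => _; last by rewrite add0r sumr_ge0.
  apply: (@le_trans _ _ (\sum_(b in T S) \sum_c ((adj peel_rest S b c)%:R + (b == b0)%:R * f S c))).
    apply: ler_sum => b _; apply: ler_sum => c _.
    have r0 : 0 <= (b == b0)%:R * f S c by rewrite mulr_ge0.
    case: (boolP (adj peel_rest S b c)) => [_|]; first by rewrite ler_wpDr // ler_indicator.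
    rewrite negb_forall => /existsP [i hi]; rewrite add0r.
    case: (boolP (adj H S b c)) => // hadj.
    move: hi; rewrite /peel_rest (forallP hadj i) /= negbK => /andP [/eqP eb].
    rewrite eb eqxx mul1r in r0 *; rewrite eb in hadj; rewrite /f hadj /= => /orP [hX|->]; last first.
      by rewrite lerDl; do 2!apply: sumr_ge0 => ? _.
    rewrite ler_wpDl // (bigD1 i) //= (bigD1 (S i)) //= eqxx /= -addrA lerDl.
    by rewrite addr_ge0 ?sumr_ge0 // => j _; rewrite sumr_ge0.
  rewrite (eq_bigr (fun b => \sum_c (adj peel_rest S b c)%:R + (b == b0)%:R * \sum_c f S c)); last first.
    by move=> b _; rewrite big_split mulr_sumr.
  rewrite big_split lerD2l /= [leLHS]big_mkcond.
  rewrite [leRHS](_ : _ = \sum_b (b == b0)%:R * \sum_c f S c); last first.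
    rewrite -mulr_suml sum_indicator (_ : [set b | b == b0] = [set b0]) ?cards1 ?mul1r //.
    by apply/setP => x; rewrite !inE.
  by apply: ler_sum => b _; case: ifP => // _; rewrite mulr_ge0 // sumr_ge0.
rewrite lerD2l exchange_big.
under eq_bigr do rewrite big_split /=.
rewrite big_split; apply: lerD => /=.
  apply: (@le_trans _ _ (\sum_c (c \in Y)%:R * D ^+ s)); last first.
    rewrite -mulr_suml sum_indicator cardsE exprS; apply: ler_wpM2r; last exact: card_Y.
    exact: exprn_ge0.
  apply: ler_sum => c _; case: (c \in Y); last by rewrite mul0r big1 // => S _; rewrite andbF.
  by rewrite mul1r; under eq_bigr do rewrite andbT; apply: sum_adj_tuple_le.
rewrite -[X in X%:R * _](card_ord s).
under eq_bigr do rewrite exchange_big /=.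
rewrite exchange_big; apply: sum_const_le => i.
under eq_bigr do rewrite exchange_big /=.
rewrite exchange_big; apply: (@le_trans _ _ (#|X|%:R * D ^+ s)).
  apply: sum_set_const_le => x _.
  apply: (@le_trans _ _ (\sum_c (H x b0 c)%:R * D ^+ s.-1)).
    by apply: ler_sum => c _; apply: sum_adj_tuple_fix_le.
  have -> : D ^+ s = D * D ^+ s.-1 by rewrite -exprS prednK.
  rewrite -mulr_suml.
  by apply: ler_wpM2r; [apply: exprn_ge0|have [] := bH x b0].
by apply: ler_wpM2r; [apply: exprn_ge0|exact: card_X].
Qed.

End Peel.

(** The loss of stars in one peeling step, as bounded in [stars_peel]. *)
Definition peel_cost D thr : R := D ^+ s.+1 + s%:R * (D ^+ 2 / thr * D ^+ s).

Lemma shadow_false : shadow (fun _ _ _ => false) = 0.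
Proof.
rewrite /shadow big1 // => b _; rewrite big1 // => S _.
by case: existsP => // - [c /forallP /(_ (Ordinal s_gt0))].
Qed.

Lemma edges_false : edges (fun _ _ _ => false) = 0.
Proof. by do 3!rewrite /edges big1 // => ? _. Qed.

Lemma edges_natr G : edges G = (\sum_x \sum_b \sum_c (G x b c : nat))%:R.
Proof.
rewrite natr_sum; apply: eq_bigr => x _; rewrite natr_sum; apply: eq_bigr => b _.
by rewrite natr_sum.
Qed.

(** Peel as long as more than [N0] stars remain. Each round adds at least k * thr edges to [G], and
    all three inequalities charge the star loss or the shadow growth of a round to these edges. *)
Lemma peel_all T H (m D thr k : R) : 0 <= D -> 0 < thr -> 0 < k ->
  (forall S, #|T S|%:R <= m) -> bounded D H ->
  exists G, [/\ subtriple G H,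
    k * thr * (stars T H - (n ^+ s * (m * thr) + n ^+ 2 * (D * k ^+ s.-1)))
      <= edges G * peel_cost D thr,
    k * thr * shadow G <= edges G * (D ^+ 2 / thr) ^+ s &
    k * thr * shadow (rev G) <= edges G * D ^+ s].
Proof.
move=> D0 thr0 k0 hm; set N0 := (X in _ - X).
have kt0 : 0 < k * thr by rewrite mulr_gt0.
have Xm0 : 0 <= D ^+ 2 / thr by rewrite divr_ge0 ?exprn_ge0 // ltW.
have W0 : 0 <= peel_cost D thr.
  apply: addr_ge0; first exact: exprn_ge0.
  by apply: mulr_ge0 => //; apply: mulr_ge0 => //; apply: exprn_ge0.
have [N] := ubnP (\sum_x \sum_b \sum_c (H x b c : nat))%N.
elim: N H => // N IH H hN bH.
have [hst|hst] := leP (stars T H) N0.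
  exists (fun _ _ _ => false); split=> //.
  - by rewrite edges_false mul0r; apply: mulr_ge0_le0; [exact: ltW|lra].
  - by rewrite shadow_false edges_false mulr0 mul0r.
  - by rewrite (shadow_false : shadow (rev _) = 0) edges_false mulr0 mul0r.
have [x0 [b0 hX]] := exists_rich_vertex D0 (ltW thr0) (ltW k0) hm bH hst.
pose H1 := peel_rest H thr x0 b0.
have hoff : k * thr <= edges (peel_off H thr x0 b0).
  apply: le_trans (edges_peel_off _ _ _ _).
  by apply: ler_wpM2r; [exact: ltW|exact: ltW].
have hH1 : edges H1 + edges (peel_off H thr x0 b0) <= edges H by exact: edges_peel.
have [||G [Gsub G1 G2 G3]] := IH H1.
- rewrite -ltnS; apply: leq_trans hN; rewrite ltnS -(ltr_nat R) -!edges_natr.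
  by lra.
- exact: sub_bounded (@peel_rest_sub _ _ _ _) bH.
exists (glue H thr x0 b0 G); rewrite edges_glue // !mulrDl; split.
- exact: glue_sub.
- have := stars_peel x0 b0 bH D0 thr0 T; rewrite -/(peel_cost D thr) -/H1 => hp.
  have h1 : k * thr * (stars T H - N0) <= k * thr * (stars T H1 - N0 + peel_cost D thr).
    by apply: ler_wpM2l; [exact: ltW|lra].
  apply: (le_trans h1); rewrite mulrDr; apply: lerD => //.
  by apply: ler_wpM2r.
- apply: (le_trans (ler_wpM2l (ltW kt0) (shadow_glue Gsub))).
  rewrite mulrDr; apply: lerD => //; apply: ler_pM; [exact: ltW|exact: exprn_ge0|exact: hoff|].
  by apply: lerXn2r; rewrite ?nnegrE //; apply: card_X.
- apply: (le_trans (ler_wpM2l (ltW kt0) (shadow_rev_glue Gsub))).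
  rewrite mulrDr; apply: lerD => //; apply: ler_pM; [exact: ltW|exact: exprn_ge0|exact: hoff|].
  by apply: lerXn2r; rewrite ?nnegrE //; apply: card_Y.
Qed.

(** * Clustered subhypergraphs *)

Section Exponents.
Hypothesis s_gt1 : (1 < s)%N.

(* Here and below constants are absorbed into powers of mu or lam; both thr and k of
   [peel_all] are D / mu^2. *)
Lemma exists_clustered T H (m D mu : R) : 0 < D -> bounded D H -> 0 <= m ->
  (forall S, #|T S|%:R <= m) -> n ^+ (s - 2) <= D ^+ s.-1 ->
  4 <= mu -> 4 * m <= mu -> s%:R <= mu -> n ^+ 2 * D ^+ s <= mu * stars T H ->
  exists G, [/\ subtriple G H, n ^+ 2 * D <= mu ^+ 10 * edges G,
    shadow G <= mu ^+ (2 * s + 4) * (n ^+ 2 * D ^+ s.-1) &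
    shadow (rev G) <= mu ^+ (2 * s + 4) * (n ^+ 2 * D ^+ s.-1)].
Proof.
move=> D0 bH m0 hm nD mu4 mum mus hst.
have mu0 : 0 < mu by lra.
have mu20 : 0 < mu ^+ 2 by rewrite exprn_gt0.
pose q := D / mu ^+ 2.
have q0 : 0 < q by rewrite divr_gt0.
have n20 : 0 <= n ^+ 2 by rewrite exprn_ge0.
have Dp k : 0 < D ^+ k by rewrite exprn_gt0.
have mup k : 0 < mu ^+ k by rewrite exprn_gt0.
have [G [Gsub G1 G2 G3]] := peel_all (ltW D0) q0 q0 hm bH.
have e0 := edges_ge0 G.
have heD := edges_le (sub_bounded Gsub bH).
have qmu : q * mu ^+ 2 = D by rewrite /q divfK // gt_eqF.
clearbody q.
have kqq : q * q * mu ^+ 4 = D ^+ 2 by rewrite -qmu; ring.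
have Dq : D ^+ 2 / q = mu ^+ 2 * D.
  have q1 : q != 0 by rewrite gt_eqF.
  by apply: (mulIf q1); rewrite divfK // expr2 -{1}qmu; ring.
have Ds : D ^+ s = D * D ^+ s.-1 by rewrite -exprS prednK.
pose P := n ^+ 2 * D ^+ s.-1.
have P0 : 0 <= P by nonneg.
have hA : n ^+ 2 * D ^+ s = P * D by rewrite Ds /P; ring.
(* [term1] and [term2] bound the two summands of the stopping threshold by P D / (4 mu) each, so at
   least P D / (2 mu) stars have to be destroyed by peeling. *)
have term1 : n ^+ s * (m * q) * (4 * mu) <= P * D.
  have h1 : n ^+ s <= P by rewrite -(subnK s_gt1) exprD mulrC; apply: ler_wpM2l.
  rewrite (_ : _ * _ = n ^+ s * (q * mu * (4 * m))); last by ring.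
  rewrite (_ : P * D = P * (q * mu * mu)); last by rewrite -qmu; ring.
  apply: ler_pM => //; first by rewrite exprn_ge0.
    by nonneg.
  by apply: ler_wpM2l => //; nonneg.
have term2 : n ^+ 2 * (D * q ^+ s.-1) * (4 * mu) <= P * D.
  have h1 : q ^+ s.-1 * mu ^+ 2 <= D ^+ s.-1.
    have e : s.-1 = (s - 2).+1 by case: s s_gt1 => [|[|?]] // _; rewrite subn2.
    rewrite -qmu exprMn; apply: ler_wpM2l; first by nonneg.
    by rewrite e; apply: ler_eXnr => //; apply: exprn_ege1; lra.
  rewrite (_ : _ * _ = n ^+ 2 * D * (q ^+ s.-1 * (4 * mu))); last by ring.
  rewrite (_ : P * D = n ^+ 2 * D * D ^+ s.-1); last by rewrite /P; ring.
  apply: ler_wpM2l; first by nonneg.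
  apply: le_trans h1; apply: ler_wpM2l; first by nonneg.
  by rewrite expr2; apply: ler_wpM2r; [exact: ltW|].
have hcost : peel_cost D q <= D ^+ s.+1 * mu ^+ 4.
  rewrite /peel_cost Dq exprS.
  rewrite (_ : _ + _ = D * D ^+ s * (1 + s%:R * mu ^+ 2)); last by ring.
  apply: ler_wpM2l; first by nonneg.
  have h : s%:R * mu ^+ 2 <= mu * mu ^+ 2 by apply: ler_wpM2r => //; apply: ltW.
  have h2 : 4 * mu ^+ 3 <= mu ^+ 4 by rewrite [mu ^+ 4]exprS; apply: ler_wpM2r => //; apply: ltW.
  have h3 : 1 <= mu ^+ 3 by apply: exprn_ege1; lra.
  move: h; rewrite -exprS; lra.
(* Divide the number of destroyed stars by the cost of a round. The power 9 is 1 from the star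
   count, 4 from [hcost] and 4 from q^2 = D^2 / mu^4. *)
have main : n ^+ 2 * D <= 2 * mu ^+ 9 * edges G.
  rewrite -(ler_pM2r (Dp s.+1)).
  have h0 : P * D <= 2 * mu * (stars T H - (n ^+ s * (m * q) + n ^+ 2 * (D * q ^+ s.-1))).
    by move: hst; rewrite hA; lra.
  have h1 : q * q * (P * D) <= 2 * mu * (edges G * peel_cost D q).
    apply: (@le_trans _ _ (2 * mu * (q * q * (stars T H - (n ^+ s * (m * q) + n ^+ 2 * (D * q ^+ s.-1)))))).
      by rewrite [leRHS]mulrCA; apply: ler_wpM2l => //; nonneg.
    by apply: ler_wpM2l => //; nonneg.
  have h2 : edges G * peel_cost D q <= edges G * (D ^+ s.+1 * mu ^+ 4) by apply: ler_wpM2l.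
  have h3 : q * q * (P * D) <= 2 * mu * (edges G * (D ^+ s.+1 * mu ^+ 4)).
    by apply: (le_trans h1); apply: ler_wpM2l => //; nonneg.
  have h4 := ler_wpM2l (ltW (mup 4)) h3.
  apply: (@le_trans _ _ (mu ^+ 4 * (q * q * (P * D)))).
    rewrite (_ : _ * (_ * _) = q * q * mu ^+ 4 * (P * D)); last by ring.
    by rewrite kqq [D ^+ s.+1]exprS Ds /P le_eqVlt; apply/orP; left; apply/eqP; ring.
  by apply: (le_trans h4); rewrite le_eqVlt; apply/orP; left; apply/eqP; ring.
(* The degree bound gives edges G <= n^2 D, which limits the total charge for the shadows. *)
have shadow_bound (x : R) :
    q * q * x <= edges G * (mu ^+ 2 * D) ^+ s -> x <= mu ^+ (2 * s + 4) * P.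
  move=> h; have D2 := Dp 2.
  rewrite -(ler_pM2l D2) -kqq.
  have h2 : edges G * (mu ^+ 2 * D) ^+ s <= n ^+ 2 * D * (mu ^+ 2 * D) ^+ s.
    by apply: ler_wpM2r => //; nonneg.
  have := ler_wpM2l (ltW (mup 4)) (le_trans h h2).
  rewrite exprMn -exprM Ds exprD /P => h3.
  rewrite (_ : _ * x = mu ^+ 4 * (q * q * x)); last by ring.
  apply: (le_trans h3); rewrite kqq le_eqVlt; apply/orP; left; apply/eqP; ring.
exists G; split=> //.
- apply: (le_trans main); apply: ler_wpM2r => //.
  by rewrite [mu ^+ 10]exprS; apply: ler_wpM2r; [exact: ltW|lra].
- by apply: shadow_bound; rewrite -Dq.
- apply: shadow_bound; apply: (le_trans G3); apply: ler_wpM2l => //.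
  apply: lerXn2r; rewrite ?nnegrE; [by nonneg|by nonneg|].
  rewrite ler_pMl // exprn_ege1 //; lra.
Qed.

(** The average degree of a pair (b, c) is at least D / lam, so [stars_lower] applies with th = D /
    lam^2; then th / 2 >= D / lam^3. *)
Lemma stars_dense G (D lam : R) : 0 < D -> n ^+ 2 * D <= lam * edges G ->
  4 <= lam -> 2 * s%:R * lam ^+ 2 <= D ->
  2 * (n ^+ 2 * D ^+ s) <= lam ^+ (3 * s) * stars (fun=> setT) G.
Proof.
move=> D0 he lam4 hD.
have lam0 : 0 < lam by lra.
have lamp k : 0 < lam ^+ k by rewrite exprn_gt0.
have e0 := edges_ge0 G.
have n20 : 0 <= n ^+ 2 by rewrite exprn_ge0.
pose th := D / lam ^+ 2.
have thlam : th * lam ^+ 2 = D by rewrite divfK // gt_eqF.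
have th0 : 0 < th by rewrite divr_gt0.
have h2 : 2 * s%:R <= th by rewrite ler_pdivlMr.
clearbody th.
have h1 : (\sum_(b : V) \sum_(c : V) true%:R) * th <= edges G / 2.
  have -> : \sum_(b : V) \sum_(c : V) true%:R = n ^+ 2 :> R.
    by rewrite !sumr_const -!mulrnA mul1n -natrX -mulnn.
  have : n ^+ 2 * th * lam <= edges G.
    rewrite -(ler_pM2l lam0); apply: le_trans he.
    by rewrite -thlam le_eqVlt; apply/orP; left; apply/eqP; ring.
  have : n ^+ 2 * th * 2 <= n ^+ 2 * th * lam.
    by apply: ler_wpM2l; [nonneg|lra].
  lra.
have := @stars_lower (fun _ _ => true) th G (fun _ _ _ _ => isT) h1 h2.
rewrite -(ler_pM2l (lamp (3 * s)%N)); apply: le_trans.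
have Ds : D ^+ s = D * D ^+ s.-1 by rewrite -exprS prednK.
have hth : D ^+ s.-1 <= lam ^+ (3 * s.-1) * (th / 2) ^+ s.-1.
  rewrite exprM -exprMn; apply: lerXn2r; rewrite ?nnegrE; first exact: ltW.
    by nonneg.
  rewrite -thlam [lam ^+ 3]exprSr (_ : _ * (th / 2) = th * lam ^+ 2 * (lam / 2)); last by ring.
  by rewrite ler_pMr ?mulr_gt0 //; lra.
have -> : lam ^+ (3 * s) = lam ^+ 3 * lam ^+ (3 * s.-1).
  by rewrite -exprD -mulnS prednK.
rewrite [leRHS](_ : _ = lam ^+ 2 / 2 * (lam * edges G) * (lam ^+ (3 * s.-1) * (th / 2) ^+ s.-1)); last by ring.
rewrite Ds [leLHS](_ : _ = 2 * (n ^+ 2 * D) * D ^+ s.-1); last by ring.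
apply: ler_pM; try by nonneg.
apply: ler_pM; try by nonneg.
have : 4 * lam <= lam ^+ 2 by rewrite expr2; apply: ler_wpM2r; [exact: ltW|].
lra.
Qed.

(** By [stars_split], [G] or [swap G] carries half of the stars; cluster that one with mu = lam^(3
    s). *)
Lemma exists_clustered_dense T G (m D lam : R) : 0 < D -> bounded D G -> 0 <= m ->
  (forall S, #|T S|%:R <= m) -> covers T G -> n ^+ (s - 2) <= D ^+ s.-1 ->
  4 <= lam -> 4 * m <= lam -> s%:R <= lam -> 2 * s%:R * lam ^+ 2 <= D ->
  n ^+ 2 * D <= lam * edges G ->
  exists K, [/\ subtriple K G \/ subtriple K (swap G),
    n ^+ 2 * D <= lam ^+ (30 * s) * edges K,
    shadow K <= lam ^+ (3 * s * (2 * s + 4)) * (n ^+ 2 * D ^+ s.-1) &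
    shadow (rev K) <= lam ^+ (3 * s * (2 * s + 4)) * (n ^+ 2 * D ^+ s.-1)].
Proof.
move=> D0 bG m0 hm cT nD lam4 lamm lams hD he.
have hst := stars_dense D0 he lam4 hD.
have split := stars_split cT.
have lam1 : 1 <= lam by lra.
have hmu : lam <= lam ^+ (3 * s) by apply: ler_eXnr; rewrite // muln_gt0.
have [h1 h2 h3] : [/\ 4 <= lam ^+ (3 * s), 4 * m <= lam ^+ (3 * s) & s%:R <= lam ^+ (3 * s)].
  by split; lra.
have mup : 0 <= lam ^+ (3 * s) by lra.
have conclude H : bounded D H -> n ^+ 2 * D ^+ s <= lam ^+ (3 * s) * stars T H ->
    exists K, [/\ subtriple K H,
    n ^+ 2 * D <= lam ^+ (30 * s) * edges K,
    shadow K <= lam ^+ (3 * s * (2 * s + 4)) * (n ^+ 2 * D ^+ s.-1) &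
    shadow (rev K) <= lam ^+ (3 * s * (2 * s + 4)) * (n ^+ 2 * D ^+ s.-1)].
  move=> bH hH; have [K [K1 K2 K3 K4]] := exists_clustered D0 bH m0 hm nD h1 h2 h3 hH.
  exists K; split; [by [] | | by rewrite exprM | by rewrite exprM].
  by rewrite (_ : 30 * s = 3 * s * 10)%N 1?exprM // mulnAC.
have [hG|hG] := leP (n ^+ 2 * D ^+ s) (lam ^+ (3 * s) * stars T G).
  by have [K [K1 K2 K3 K4]] := conclude G bG hG; exists K; split=> //; left.
have [|K [K1 K2 K3 K4]] := conclude (swap G) (bounded_swap bG).
  have := ler_wpM2l mup split; rewrite mulrDr; lra.
by exists K; split=> //; right.
Qed.

(** Three factors of the final comparison in [dense_bound]: the star count at density [lam3], the
    shadow bound at density [lam2], and one [lam] paying for m. *)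
Definition density_exponent := (30 * s * (30 * s) * (3 * s) + 30 * s * (3 * s * (2 * s + 4)) + 1)%N.

(* The first clustering has its centre in class 2, the second in class 1 or 3; the
   remaining class carries the final star count. *)
Lemma dense_bound T (E G : V -> V -> V -> bool) (m D lam : R) :
  (forall x b c, E x b c -> E x c b) -> (forall x b c, E x b c -> E b x c) ->
  0 < n -> 0 < D -> 0 <= m -> (forall S, #|T S|%:R <= m) -> covers T E ->
  subtriple G E -> bounded D G -> n ^+ (s - 2) <= D ^+ s.-1 ->
  4 <= lam -> 4 * m <= lam -> s%:R <= lam -> n ^+ 2 * D <= lam * edges G ->
  D <= lam ^+ density_exponent.
Proof.
move=> E23 E12 n0 D0 m0 hm cE GE bG nD lam4 lamm lams he.
have [//|hlt] := leP D (lam ^+ density_exponent).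
have lam1 : 1 <= lam by lra.
pose lam2 := lam ^+ (30 * s); pose lam3 := lam2 ^+ (30 * s).
have hlam2 : lam <= lam2 by apply: ler_eXnr; rewrite // muln_gt0.
have lam2_1 : 1 <= lam2 by lra.
have hlam3 : lam2 <= lam3 by apply: ler_eXnr; rewrite // muln_gt0.
have lam3E : lam3 = lam ^+ (30 * s * (30 * s)) by rewrite /lam3 /lam2 -exprM.
have hD3 : 2 * s%:R * lam3 ^+ 2 <= D.
  apply/ltW; apply: le_lt_trans hlt.
  apply: (@le_trans _ _ (lam ^+ 2 * lam3 ^+ 2)).
    apply: ler_wpM2r; first by rewrite exprn_ge0 //; lra.
    by rewrite expr2; apply: ler_pM => //; lra.
  rewrite lam3E -exprM -exprD; apply: ler_weXn2l => //.
  have u1 : (0 < 30 * s * (30 * s))%N by rewrite !muln_gt0 /= s_gt0.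
  rewrite /density_exponent; move: (30 * s * (30 * s))%N u1 => u u1.
  apply: (@leq_trans (u * 6)); first by rewrite (_ : 6 = 4 + 2)%N // mulnDr leq_add2r (leq_trans _ (leq_pmull 4 u1)).
  by rewrite -addnA; apply: leq_trans (leq_addr _ _); rewrite leq_mul2l (leq_mul2l 3 2) s_gt1 !orbT.
have lam_sq (a b : R) : 0 <= a -> a <= b -> 2 * s%:R * a ^+ 2 <= 2 * s%:R * b ^+ 2.
  move=> a0 ab; apply: ler_wpM2l; first by nonneg.
  by apply: lerXn2r; rewrite ?nnegrE //; lra.
have hD2 : 2 * s%:R * lam2 ^+ 2 <= D by apply: le_trans hD3; apply: lam_sq; lra.
have hD1 : 2 * s%:R * lam ^+ 2 <= D by apply: le_trans hD2; apply: lam_sq; lra.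
have [G1 [G1sub G1e G1s G1r]] :=
  exists_clustered_dense D0 bG m0 hm (sub_covers GE cE) nD lam4 lamm lams hD1 he.
have G1E : subtriple G1 E by case: G1sub => h x b c /h hG; [apply: GE|apply/E23/GE].
have bG1 : bounded D G1 by case: G1sub => /sub_bounded; apply; [|apply: bounded_swap].
(* Moves the centre of the first clustering to the first position, so the second one is centred
   elsewhere. *)
pose G1' b x c := G1 x b c.
have bG1' : bounded D G1'.
  by move=> u v; have [h1 h2 h3] := bG1 u v; have [h1' h2' h3'] := bG1 v u; split.
have cG1' : covers T G1' by apply: sub_covers cE => b x c /G1E/E12.
have eG1' : edges G1' = edges G1 by rewrite /edges exchange_big.
rewrite -eG1' in G1e.
have [] := exists_clustered_dense D0 bG1' m0 hm cG1' nD _ _ _ hD2 G1e; try lra.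
move=> G2 [G2sub G2e G2s G2r].
(* The first class of [K] is the centre of neither clustering. Its pairs with the second class are
   scarce by the second clustering, those with the third class by the first. *)
pose K := rev G2.
have KE : subtriple K E.
  case: G2sub => h; first by move=> c x b /h/G1E/E23/E12.
  by move=> x c b /h/G1E/E23.
have K1 : shadow K <= lam2 ^+ (3 * s * (2 * s + 4)) * (n ^+ 2 * D ^+ s.-1) by [].
have K2 : shadow (swap K) <= lam ^+ (3 * s * (2 * s + 4)) * (n ^+ 2 * D ^+ s.-1).
  case: G2sub => h; [apply: le_trans G1r|apply: le_trans G1s]; apply: sub_shadow.
    by move=> c b x /h.
  by move=> x b c /h.
have eK : edges K = edges G2.
  rewrite /edges [RHS]exchange_big; under [RHS]eq_bigr do rewrite exchange_big /=.
  by rewrite [RHS]exchange_big; apply: eq_bigr => c _; rewrite exchange_big.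
rewrite -/lam3 -eK in G2e.
have lam3_4 : 4 <= lam3 by lra.
have := stars_dense D0 G2e lam3_4 hD3.
have := stars_le_shadow hm (sub_covers KE cE).
set P := n ^+ 2 * D ^+ s.-1 in K1 K2 *.
have P0 : 0 < P by rewrite mulr_gt0 // exprn_gt0.
set Z := lam2 ^+ _ in K1; have K2' : shadow (swap K) <= Z * P.
  apply: (le_trans K2); apply: ler_wpM2r; first exact: ltW.
  by apply: lerXn2r; rewrite ?nnegrE //; lra.
have l30 k : 0 <= lam3 ^+ k by rewrite exprn_ge0 //; lra.
move=> hst hd.
have : 2 * (P * D) <= lam3 ^+ (3 * s) * (m * (2 * (Z * P))).
  rewrite (_ : P * D = n ^+ 2 * D ^+ s); last first.
    by rewrite /P -mulrA -exprSr prednK.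
  apply: (le_trans hd); apply: ler_wpM2l => //; apply: (le_trans hst).
  by apply: ler_wpM2l => //; lra.
rewrite [leRHS](_ : _ = 2 * (P * (lam3 ^+ (3 * s) * Z * m))); last by ring.
rewrite ler_pM2l // ler_pM2l // => hfin.
suff : lam3 ^+ (3 * s) * Z * m <= lam ^+ density_exponent by lra.
rewrite /Z lam3E /lam2 -!exprM -exprD /density_exponent addn1 exprSr.
apply: ler_wpM2l; last by lra.
by rewrite exprn_ge0 //; lra.
Qed.

(** * Layers of constant pair degree *)

Section Levels.
Hypothesis s_gt2 : (2 < s)%N.

(* If all pair degrees are at most lam tau and those into class 1 are at least tau,
   then each pair (S, b) with b in T S lies in at most lam tau stars, while there
   are at least about e0 tau^(s-1) stars. *)
Lemma level_bound T (Q : rel V) G (m e0 D0 lam tau : R) :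
  0 < tau -> 0 < D0 -> 0 < n -> 0 <= m -> (forall S, #|T S|%:R <= m) -> covers T G ->
  bounded (lam * tau) G -> (forall x b c, G x b c -> Q b c) ->
  (\sum_b \sum_c (Q b c)%:R) * tau <= e0 -> e0 <= lam ^+ 2 * edges G ->
  n ^+ 2 * D0 <= lam * e0 -> D0 ^+ s.-1 = n ^+ (s - 2) ->
  4 <= lam -> 4 * m <= lam -> 2 * s%:R * lam ^+ 3 <= tau ->
  tau <= lam ^+ (4 * s + 1) * D0.
Proof.
move=> tau0 D00 n0 m0 hm cT bG GQ hQ he hD0 D0n lam4 lamm htau.
have lam0 : 0 < lam by lra.
have lamp k : 0 < lam ^+ k by rewrite exprn_gt0.
have e0' := edges_ge0 G.
have np k : 0 < n ^+ k by rewrite exprn_gt0.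
(* Two factors [lam] compensate for edges G >= e0 / lam^2, and the third provides the spare factor 2
   for [stars_lower]. *)
pose th := tau / lam ^+ 3.
have thlam : th * lam ^+ 3 = tau by rewrite divfK // gt_eqF.
have th0 : 0 < th by rewrite divr_gt0.
have h2 : 2 * s%:R <= th by rewrite ler_pdivlMr.
clearbody th.
have h1 : (\sum_b \sum_c (Q b c)%:R) * th <= edges G / 2.
  have h : (\sum_b \sum_c (Q b c)%:R) * th * lam <= edges G.
    rewrite -(ler_pM2l (lamp 2)); apply: le_trans he; apply: le_trans hQ.
    by rewrite -thlam le_eqVlt; apply/orP; left; apply/eqP; ring.
  have : (\sum_b \sum_c (Q b c)%:R) * th * 2 <= (\sum_b \sum_c (Q b c)%:R) * th * lam.
    apply: ler_wpM2l; last by lra.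
    by apply: mulr_ge0; [do 2!apply: sumr_ge0 => ? _|exact: ltW].
  lra.
have hlow := stars_lower GQ h1 h2.
have htau4 : tau ^+ s.-1 <= lam ^+ (4 * s.-1) * (th / 2) ^+ s.-1.
  rewrite exprM -exprMn; apply: lerXn2r; rewrite ?nnegrE; first exact: ltW.
    by nonneg.
  rewrite -thlam [lam ^+ 4]exprSr (_ : _ * (th / 2) = th * lam ^+ 3 * (lam / 2)); last by ring.
  by rewrite ler_pMr ?mulr_gt0 //; lra.
have lt0 : 0 <= lam * tau by nonneg.
have hup : stars (fun=> setT) G <= 2 * (n ^+ s * (m * (lam * tau))).
  apply: (le_trans (stars_split cT)).
  have := stars_le lt0 hm bG; have := stars_le lt0 hm (bounded_swap bG); lra.
have h4 : lam ^+ (4 * s) = lam ^+ 4 * lam ^+ (4 * s.-1) by rewrite -exprD -mulnS prednK.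
have hmid : n ^+ 2 * D0 * tau ^+ s.-1 <= lam ^+ (4 * s + 1) * n ^+ s * tau.
  apply: (@le_trans _ _ (lam * (lam ^+ 2 * edges G) * (lam ^+ (4 * s.-1) * (th / 2) ^+ s.-1))).
    apply: ler_pM => //; [by nonneg|by nonneg|].
    by apply: (le_trans hD0); apply: ler_wpM2l => //; exact: ltW.
  rewrite (_ : _ * _ = 2 * (lam ^+ 3 * lam ^+ (4 * s.-1)) * (edges G / 2 * (th / 2) ^+ s.-1)); last by field.
  apply: (@le_trans _ _ (2 * (lam ^+ 3 * lam ^+ (4 * s.-1)) * (2 * (n ^+ s * (m * (lam * tau)))))).
    apply: ler_wpM2l; first by nonneg.
    exact: le_trans hup.
  rewrite (_ : _ * _ = lam ^+ 4 * lam ^+ (4 * s.-1) * n ^+ s * tau * (4 * m)); last by ring.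
  rewrite -h4 exprD expr1 [leRHS](_ : _ = lam ^+ (4 * s) * n ^+ s * tau * lam); last by ring.
  by apply: ler_wpM2l => //; nonneg.
have e1 : s.-1 = (s - 2).+1 by case: s s_gt2 => [|[|[|?]]].
have e2 : s = (s - 2 + 2)%N by rewrite subnK // ltnW.
have hns : n ^+ s = n ^+ 2 * (D0 * D0 ^+ (s - 2)).
  by rewrite -exprS -e1 D0n -exprD addnC -e2.
(* Lower and upper star counts compare n^2 D0 tau^(s-1) with n^s tau. Since n^s = n^2 D0^(s-1),
   powers s - 2 remain, and s > 2 allows taking the root. *)
have hfin : tau ^+ (s - 2) <= lam ^+ (4 * s + 1) * D0 ^+ (s - 2).
  have pos : 0 < n ^+ 2 * D0 * tau by rewrite !mulr_gt0.
  rewrite -(ler_pM2l pos).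
  rewrite [leLHS](_ : _ = n ^+ 2 * D0 * tau ^+ s.-1); last by rewrite e1 [tau ^+ _.+1]exprS; ring.
  apply: (le_trans hmid); rewrite hns le_eqVlt; apply/orP; left; apply/eqP; ring.
rewrite -(@ler_pXn2r _ (s - 2)) ?nnegrE ?subn_gt0 //; last 2 first.
- exact: ltW.
- by nonneg.
apply: (le_trans hfin); rewrite exprMn; apply: ler_wpM2r; first by nonneg.
by apply: ler_eXnr; rewrite ?subn_gt0 // exprn_ege1 //; lra.
Qed.

Section Symmetric.
Variable E : V -> V -> V -> bool.
Hypotheses (E23 : forall x b c, E x b c -> E x c b) (E12 : forall x b c, E x b c -> E b x c).

Definition codeg b c : R := \sum_x (E x b c)%:R.
Definition weight x b c := Num.max (codeg b c) (Num.max (codeg x c) (codeg x b)).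

Let Esw x b c : E x b c = E x c b.
Proof. by apply/idP/idP => /E23. Qed.

Let Erot x b c : E x b c = E b x c.
Proof. by apply/idP/idP => /E12. Qed.

Lemma sum_mid u v : \sum_w (E u w v)%:R = codeg u v.
Proof. by apply: eq_bigr => w _; rewrite Erot. Qed.

Lemma sum_last u v : \sum_w (E u v w)%:R = codeg u v.
Proof. by rewrite -sum_mid; apply: eq_bigr => w _; rewrite Esw. Qed.

Lemma codeg_le b c : codeg b c <= n.
Proof.
rewrite -[leRHS]mulr1; apply: sum_const_le => x.
by rewrite (ler_nat _ _ 1) leq_b1.
Qed.

Definition level lam j x b c := E x b c && (lam ^+ j <= weight x b c).
(** Dyadic decomposition with ratio [lam]: the weight lies between lam^j and lam^(j+1). *)
Definition layer lam j x b c := level lam j x b c && ~~ level lam j.+1 x b c.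

(** A pair inside an edge of the layer has degree below lam^(j+1) already in [E], since the weight
    is a maximum; any other pair has degree 0 in the layer. *)
Lemma layer_bounded lam j : 0 <= lam -> bounded (lam * lam ^+ j) (layer lam j).
Proof.
move=> lam0.
have h (f : V -> bool) (d : R) (g : V -> bool) : (forall w, g w -> f w) ->
    \sum_w (f w)%:R = d -> (forall w, g w -> d <= lam * lam ^+ j) ->
    \sum_w (g w)%:R <= lam * lam ^+ j.
  move=> gf fd gd; case: (pickP g) => [w hw|h0]; last first.
    by rewrite big1 => [|w _]; rewrite ?h0 // mulr_ge0 // exprn_ge0.
  apply: le_trans (gd w hw); rewrite -fd; apply: ler_sum => w' _.
  exact/ler_indicator/gf.
have lw x b c : layer lam j x b c -> [/\ E x b c, codeg b c <= lam * lam ^+ j,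
   codeg x c <= lam * lam ^+ j & codeg x b <= lam * lam ^+ j].
  case/andP => /andP [hE _]; rewrite /level hE /= -ltNge exprS /weight !gt_max.
  by case/and3P => h1 h2 h3; split=> //; apply: ltW.
move=> u v; split.
- by apply: (h (fun w => E w u v) (codeg u v)) => // w /lw [].
- by apply: (h (fun w => E u w v) (codeg u v)) => [w /lw []| |w /lw []] //; apply: sum_mid.
- by apply: (h (fun w => E u v w) (codeg u v)) => [w /lw []| |w /lw []] //; apply: sum_last.
Qed.

Lemma edges_layer lam j : 1 <= lam ->
  edges (layer lam j) = edges (level lam j) - edges (level lam j.+1).
Proof.
move=> lam1; apply/eqP; rewrite eq_sym subr_eq -big_split; apply/eqP.
apply: eq_bigr => x _; rewrite -big_split; apply: eq_bigr => b _.
rewrite -big_split; apply: eq_bigr => c _ /=; rewrite /layer.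
case: (boolP (level lam j.+1 x b c)) => [/andP [hE hw]|_]; last by rewrite andbT addr0.
rewrite andbF add0r /level hE (_ : lam ^+ j <= _) //.
by apply: le_trans hw; apply: ler_weXn2l.
Qed.

(* Pigeonhole over the J + 1 layers. *)
Lemma exists_layer lam J : 1 < lam -> n <= lam ^+ J -> J.+1%:R < lam -> 0 < edges E ->
  exists j, edges E <= lam * edges (layer lam j).
Proof.
move=> lam1 nJ hJ e0.
have lev0 : edges (level lam 0) = edges E.
  apply: eq_bigr => x _; apply: eq_bigr => b _; apply: eq_bigr => c _.
  congr (_%:R); rewrite /level expr0; case: (boolP (E x b c)) => //= hE.
  rewrite /weight !le_max (_ : 1 <= codeg b c) // /codeg (bigD1 x) //= hE.
  by rewrite lerDl sumr_ge0.
have levJ : edges (level lam J.+1) = 0.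
  do 3!rewrite /edges big1 // => ? _.
  rewrite /level andbC leNgt /weight !gt_max !(le_lt_trans (codeg_le _ _)) //;
  by apply: (le_lt_trans nJ); rewrite ltr_eXn2l.
case: (boolP [exists j : 'I_J.+1, edges E <= lam * edges (layer lam j)]) => [/existsP [j hj]|].
  by exists j.
rewrite negb_exists => /forallP hno.
(* If every layer had fewer than edges E / lam edges, telescoping over the levels would give lam <=
   J + 1. *)
have step k : (k <= J.+1)%N -> lam * (edges (level lam 0) - edges (level lam k)) <= k%:R * edges E.
  elim: k => [_|k IH hk]; first by rewrite subrr mulr0 mul0r.
  have := IH (ltnW hk); have := hno (Ordinal hk).
  rewrite -ltNge (edges_layer _ (ltW lam1)) /= => h1 h2.
  by rewrite -natr1 mulrDl mul1r; lra.
have := step J.+1 (leqnn _); rewrite lev0 levJ subr0 ler_pM2r // => h.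
by move: hJ; rewrite ltNge h.
Qed.

(** In each edge of the layer one of the three pairs has degree at least lam^j. Some position of
    this pair serves a third of the edges; permute the classes so that the opposite vertex comes
    first. *)
Lemma exists_oriented_layer (lam : R) j : 3 <= lam -> edges E <= lam * edges (layer lam j) ->
  exists G, [/\ subtriple G E, bounded (lam * lam ^+ j) G,
    forall x b c, G x b c -> lam ^+ j <= codeg b c & edges E <= lam ^+ 2 * edges G].
Proof.
move=> lam3 hE.
have bL := @layer_bounded lam j; have {}bL := bL (le_trans (ler0n _ 3) lam3).
have LE : subtriple (layer lam j) E by move=> x b c /andP [/andP []].
pose tau := lam ^+ j.
pose A x b c := layer lam j x b c && (tau <= codeg b c).
pose B b x c := layer lam j x b c && (tau <= codeg x c).
pose C c x b := layer lam j x b c && (tau <= codeg x b).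
have eB : edges B = \sum_x \sum_b \sum_c (B b x c)%:R by rewrite /edges exchange_big.
have eC : edges C = \sum_x \sum_b \sum_c (C c x b)%:R.
  rewrite /edges exchange_big; apply: eq_bigr => x _; exact: exchange_big.
have sumABC : edges (layer lam j) <= edges A + (edges B + edges C).
  rewrite eB eC -!big_split; apply: ler_sum => x _; rewrite -!big_split.
  apply: ler_sum => b _; rewrite -!big_split; apply: ler_sum => c _ /=.
  rewrite /A /B /C; case: (boolP (layer _ _ _ _ _)) => [/andP [/andP [_ +] _]|_]; last by rewrite !addr0.
  rewrite /weight !le_max -/tau.
  by case: (tau <= _); case: (tau <= _); case: (tau <= _) => //= _; lra.
have conclude G : edges (layer lam j) <= 3 * edges G -> edges E <= lam ^+ 2 * edges G.
  move=> h; have e0 := edges_ge0 G.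
  apply: (le_trans hE); rewrite expr2 -mulrA; apply: ler_wpM2l; first by lra.
  by apply: (le_trans h); apply: ler_wpM2r.
have [hA|hA] := leP (edges (layer lam j)) (3 * edges A).
  exists A; split; last exact: conclude.
  - by move=> x b c /andP [/LE].
  - by apply: sub_bounded bL => x b c /andP [].
  - by move=> x b c /andP [].
have [hB|hB] := leP (edges (layer lam j)) (3 * edges B).
  exists B; split; last exact: conclude.
  - by move=> b x c /andP [/LE/E12].
  - have bB : bounded (lam * lam ^+ j) (fun b x c => layer lam j x b c).
      by move=> u v; have [h1 h2 h3] := bL u v; have [h1' h2' h3'] := bL v u; split.
    by apply: sub_bounded bB => x b c /andP [].
  - by move=> x b c /andP [].
exists C; split; last by apply: conclude; lra.
- by move=> c x b /andP [/LE/E23/E12].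
- have bC : bounded (lam * lam ^+ j) (fun c x b => layer lam j x b c).
    by move=> u v; have [h1 h2 h3] := bL u v; have [h1' h2' h3'] := bL v u; split.
  by apply: sub_bounded bC => x b c /andP [].
- by move=> x b c /andP [].
Qed.

(** [dense_bound] is applied at density lam^(4 s + 5). *)
Definition total_exponent := ((4 * s + 5) * density_exponent)%N.

(** Otherwise an oriented layer has tau <= lam^(4 s + 1) D0 by [level_bound], so all its pair
    degrees are at most D = lam^(4 s + 2) D0. It is dense relative to D, and [dense_bound] forces D
    <= lam^total_exponent < D0 <= D. *)
Lemma edges_upper T (m D0 lam : R) J : 0 < n -> 0 < D0 -> 0 <= m ->
  (forall S, #|T S|%:R <= m) -> covers T E -> D0 ^+ s.-1 = n ^+ (s - 2) ->
  4 <= lam -> 4 * m <= lam -> s%:R <= lam -> n <= lam ^+ J -> J.+1%:R < lam ->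
  lam ^+ total_exponent < D0 -> lam * edges E <= n ^+ 2 * D0.
Proof.
move=> n0 D00 m0 hm cE D0n lam4 lamm lams nJ hJ hD0.
have [//|/ltW he] := leP (lam * edges E) (n ^+ 2 * D0).
exfalso.
have lam1 : 1 <= lam by lra.
have e0 : 0 < edges E.
  have : 0 < lam * edges E by apply: lt_le_trans he; rewrite mulr_gt0 // exprn_gt0.
  by rewrite pmulr_rgt0 //; lra.
have [|j hj] := exists_layer _ nJ hJ e0; first by lra.
have [|G [GE bG Gtau eG]] := exists_oriented_layer _ hj; first by lra.
set tau := lam ^+ j in bG Gtau.
have tau0 : 0 < tau by rewrite exprn_gt0 //; lra.
have hQ : (\sum_b \sum_c (tau <= codeg b c)%R%:R) * tau <= edges E.
  have -> : edges E = \sum_b \sum_c codeg b c.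
    rewrite /edges exchange_big; apply: eq_bigr => b _; exact: exchange_big.
  rewrite mulr_suml; apply: ler_sum => b _; rewrite mulr_suml; apply: ler_sum => c _.
  case: (leP tau (codeg b c)) => h; first by rewrite mul1r.
  by rewrite mul0r sumr_ge0.
have hexp : (4 * s + 5 <= total_exponent)%N.
  by rewrite /total_exponent leq_pmulr // /density_exponent addn1.
have lamD k : (k <= total_exponent)%N -> lam ^+ k <= D0.
  by move=> hk; apply: ltW; apply: le_lt_trans hD0; apply: ler_weXn2l.
(* If tau is too small for [level_bound], it is at most lam^5, which is below D0 anyway. *)
have htau : tau <= lam ^+ (4 * s + 1) * D0.
  have [h|/ltW h] := leP (2 * s%:R * lam ^+ 3) tau.
    exact: (level_bound tau0 D00 n0 m0 hm (sub_covers GE cE) bG Gtau hQ eG he D0n lam4 lamm h).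
  apply: (le_trans h); apply: (@le_trans _ _ (lam ^+ 5)).
    rewrite (_ : 5 = 2 + 3)%N // exprD; apply: ler_wpM2r; first by rewrite exprn_ge0 //; lra.
    by rewrite expr2; apply: ler_pM => //; lra.
  apply: (@le_trans _ _ D0); first by apply: lamD; apply: leq_trans hexp; apply: leq_addl.
  by rewrite ler_pMl // exprn_ege1.
pose D := lam ^+ (4 * s + 2) * D0.
have DD0 : D0 <= D by rewrite ler_pMl // exprn_ege1.
have Dpos : 0 < D by lra.
have bD : bounded D G.
  have hD : lam * tau <= D.
    have e : (4 * s + 2 = (4 * s + 1).+1)%N by rewrite addnS.
    rewrite /D e [lam ^+ _.+1]exprS -mulrA; apply: ler_wpM2l; last exact: htau.
    by lra.
  by move=> u v; have [h1 h2 h3] := bG u v; split; apply: le_trans hD.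
have nD : n ^+ (s - 2) <= D ^+ s.-1.
  by rewrite -D0n; apply: lerXn2r; rewrite ?nnegrE // ltW.
have hl : lam <= lam ^+ (4 * s + 5) by apply: ler_eXnr => //; rewrite addnS.
have eD : n ^+ 2 * D <= lam ^+ (4 * s + 5) * edges G.
  rewrite /D (_ : 4 * s + 5 = 4 * s + 2 + 3)%N; last by rewrite -addnA.
  rewrite mulrCA [leRHS](_ : _ = lam ^+ (4 * s + 2) * (lam * (lam ^+ 2 * edges G))); last first.
    by rewrite exprD; ring.
  apply: ler_wpM2l; first by rewrite exprn_ge0 //; lra.
  by apply: (le_trans he); apply: ler_wpM2l => //; lra.
have := dense_bound E23 E12 n0 Dpos m0 hm cE GE bD nD _ _ _ eD.
rewrite -exprM -/total_exponent => h.
have : D <= lam ^+ total_exponent by apply: h; lra.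
lra.
Qed.

End Symmetric.
End Levels.

End Exponents.

End Triples.

(** * From the hypergraph to ordered triples *)

Section Matchings.
Variable V : finType.
Implicit Types (L : rel V) (M : seq (V * V)).
Local Open Scope nat_scope.

Definition ends M : seq V := flatten [seq [:: e.1; e.2] | e <- M].

Lemma size_ends M : size (ends M) = (size M).*2.
Proof. by elim: M => //= e M; rewrite /ends /= => ->. Qed.

Lemma nth_ends x0 e0 M i (b : bool) : i < size M ->
  nth x0 (ends M) (i.*2 + b) = if b then (nth e0 M i).2 else (nth e0 M i).1.
Proof. by elim: M i => //= e M IH [|i] h; [clear IH; case: b|rewrite doubleS; apply: IH]. Qed.

(** A matching either extends by a disjoint edge or its endpoints meet every edge; irreflexivity
    makes the two ends of a new edge distinct. *)
Lemma matching_or_cover L t : irreflexive L ->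
  (exists M, [/\ size M = t, all (fun e => L e.1 e.2) M & uniq (ends M)]) \/
  (exists T : {set V}, #|T| <= t.*2 /\ forall b c, L b c -> (b \in T) || (c \in T)).
Proof.
move=> Lirr; elim: t => [|t [[M [Ms ML Mu]]|[T [Tt TL]]]]; first by left; exists [::].
  case: (boolP [exists p : V * V, [&& L p.1 p.2, p.1 \notin ends M & p.2 \notin ends M]]).
    case/existsP => -[b c] /= /and3P [Lbc hb hc]; left; exists ((b, c) :: M).
    rewrite /= Ms Lbc ML; split=> //=.
    rewrite -/(ends M) inE negb_or hb hc Mu !andbT.
    by apply: contraTneq Lbc => ->; rewrite Lirr.
  rewrite negb_exists => /forallP hno; right; exists [set x in ends M]; split.
    by rewrite cardsE (leq_trans (card_size _)) // size_ends Ms leq_double.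
  move=> b c Lbc; have := hno (b, c); rewrite /= Lbc /= negb_and !negbK !inE.
  by [].
by right; exists T; split=> //; apply: leq_trans Tt _; rewrite leq_double.
Qed.

End Matchings.

(** * Ordered triples of a hypergraph and covers of its common links *)

Section Hypergraph.
Variables (n s t : nat) (H : {set {set 'I_n}}).
Hypotheses (s_gt0 : (0 < s)%N) (Hunif : uniform 3 H).

Definition triple (x b c : 'I_n) := [&& x != b, x != c, b != c & x |: [set b; c] \in H].

Lemma triple23 x b c : triple x b c -> triple x c b.
Proof. by case/and4P=> h1 h2 h3 h4; rewrite /triple h2 h1 eq_sym h3 [[set c; b]]setUC. Qed.

Lemma triple12 x b c : triple x b c -> triple b x c.
Proof. by case/and4P=> h1 h2 h3 h4; rewrite /triple eq_sym h1 h2 h3 setUCA. Qed.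

Lemma card_le_edges (R : realFieldType) : #|H|%:R <= edges R triple.
Proof.
pose P (p : 'I_n * ('I_n * 'I_n)) := triple p.1 p.2.1 p.2.2.
pose f (p : 'I_n * ('I_n * 'I_n)) := p.1 |: [set p.2.1; p.2.2].
have -> : edges R triple = #|[set p | P p]|%:R.
  rewrite -sum_indicator /edges.
  under eq_bigr do rewrite pair_big.
  by rewrite pair_big.
rewrite ler_nat; apply: leq_trans (leq_imset_card f _); apply: subset_leq_card.
apply/subsetP => e eH; have /eqP e3 := implyP (forallP Hunif e) eH.
have /card_gt0P [x xe] : (0 < #|e|)%N by rewrite e3.
move: e3; rewrite (cardsD1 x) xe => -[/eqP /cards2P [b [c [bc he]]]].
have [xb xc] : x != b /\ x != c.
  have hb : b \in e :\ x by rewrite he !inE eqxx.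
  have hc : c \in e :\ x by rewrite he !inE eqxx orbT.
  by move: hb hc; rewrite !inE ![x == _]eq_sym => /andP [-> _] /andP [-> _].
have ee : e = x |: [set b; c] by rewrite -he setD1K.
apply/imsetP; exists (x, (b, c)); last by [].
by rewrite inE /P /triple /= xb xc bc -ee.
Qed.

(** A matching of size t in the common link of [S] supplies the pairs Y_1, ..., Y_t, and with X sent
    to [S] this is a copy of the forbidden hypergraph. *)
Lemma free_cover (S : {ffun 'I_s -> 'I_n}) : ~~ contains_copy (K3 s t) H ->
  injective S -> exists T : {set 'I_n}, (#|T| <= t.*2)%N /\
    forall b c, adj triple S b c -> (b \in T) || (c \in T).
Proof.
move=> Hfree injS; pose i0 := Ordinal s_gt0.
have [|[M [Ms ML Mu]]|//] := @matching_or_cover _ (adj triple S) t.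
  by move=> b; apply/negbTE/negP => /forallP /(_ i0) /and4P [_ _ /eqP].
exfalso; move/negP: Hfree; apply.
pose e0 := (S i0, S i0).
pose g (v : 'I_s + 'I_t * bool) : 'I_n := match v with
  | inl x => S x
  | inr p => nth (S i0) (ends M) (p.1.*2 + (p.2 : bool)) end.
pose f : {ffun Kvertex s t -> 'I_n} := [ffun v => g v].
have Mi (i : 'I_t) : (i < size M)%N by rewrite Ms.
have Li (i : 'I_t) x : triple (S x) (nth e0 M i).1 (nth e0 M i).2.
  by have /forallP := all_nthP e0 ML i (Mi i).
apply/existsP; exists f; apply/andP; split.
  apply/injectiveP => - [x|[i b]] [y|[j d]]; rewrite !ffunE /=.
  - by move/injS ->.
  - rewrite (nth_ends _ e0) //; have /and4P [h1 h2 _ _] := Li j x.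
    by case: d => /eqP; rewrite ?(negbTE h1) ?(negbTE h2).
  - rewrite (nth_ends _ e0) //; have /and4P [h1 h2 _ _] := Li i y.
    by case: b => /eqP; rewrite eq_sym ?(negbTE h1) ?(negbTE h2).
  - have lt (k : 'I_t) (a : bool) : (k.*2 + a < size (ends M))%N.
      rewrite size_ends Ms; apply: (@leq_trans k.+1.*2); last by rewrite leq_double.
      by rewrite doubleS ltnS; case: a; rewrite ?addn1 ?addn0.
    move/eqP; rewrite nth_uniq // => /eqP h.
    (* The ends of the i-th matching edge sit at positions 2i and 2i + 1, so parity recovers the
       boolean. *)
    have bd : b = d.
      by have := congr1 odd h; rewrite !oddD !odd_double; case: (b); case: (d).
    have /double_inj/val_inj -> : i.*2 = j.*2 by apply/eqP; rewrite -(eqn_add2r b) h bd.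
    by rewrite bd.
apply/forallP => e; apply/implyP => /imset2P [x i _ _ ->].
have -> : Kpart s i = [set inr (i, false); inr (i, true)].
  apply/setP => v; rewrite !inE; apply/imsetP/orP.
    by case=> - [] _ ->; [right|left].
  by case=> /eqP ->; [exists false|exists true].
have fr (b : bool) : f (inr (i, b)) = if b then (nth e0 M i).2 else (nth e0 M i).1.
  by rewrite ffunE /= (nth_ends _ e0).
rewrite imsetU1 imsetU1 imset_set1 !fr ffunE.
by have /and4P [] := Li i x.
Qed.

Lemma free_covers : ~~ contains_copy (K3 s t) H ->
  exists T : {ffun 'I_s -> 'I_n} -> {set 'I_n},
    (forall S, (#|T S| <= t.*2)%N) /\ covers T triple.
Proof.
move=> Hfree.
have [|T hT] := @fin_all_exists {ffun 'I_s -> 'I_n} (fun=> {set 'I_n}) (fun S T =>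
    (#|T| <= t.*2)%N /\ (injective S -> forall b c, adj triple S b c -> (b \in T) || (c \in T))).
  move=> S; case: (boolP (injectiveb S)) => [/injectiveP injS|/injectiveP ninj].
    by have [T [h1 h2]] := free_cover Hfree injS; exists T.
  (* Default value at the tuples with repetitions. *)
  by exists set0; rewrite cards0.
exists T; split=> [S|S b c injS h]; first by have [] := hT S.
by have [_ h'] := hT S; apply: h'.
Qed.

End Hypergraph.

(** * Choice of the exponents and the final estimate *)

Lemma powR_root (R : realType) (x : R) (a b : nat) : 0 <= x -> (0 < b)%N ->
  (x `^ (a%:R / b%:R)) ^+ b = x ^+ a.
Proof.
move=> x0 b0; rewrite -powR_mulrn ?powR_ge0 // -powRrM divfK ?pnatr_eq0 -?lt0n //.
exact: powR_mulrn.
Qed.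

Theorem theorem1p3 (R : realType) (s : nat) (hs : (3 <= s)%N) :
  exists2 eps : R, 0 < eps &
    forall t : nat, (0 < t)%N ->
    exists C : R, forall n : nat, (0 < n)%N ->
      (extremal 3 n (K3 s t))%:R
        <= C * n%:R `^ (3 - 1 / (s%:R - 1) - eps).
Proof.
have s0 : (0 < s)%N by apply: leq_trans hs.
have s1 : (1 < s)%N by apply: leq_trans hs.
(* With eps = 1 / (3 M) and lam = n^eps, lam^M = n^(1/3) stays below D0 = n^((s-2)/(s-1)), whose
   exponent is at least 1/2. *)
pose M := total_exponent s; pose J := (3 * M)%N.
have M0 : (0 < M)%N by rewrite /M /total_exponent /density_exponent muln_gt0 !addn1 addnS.
have J0 : (0 < J)%N by rewrite muln_gt0.
exists (1 / J%:R); first by rewrite divr_gt0 // ltr0n.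
move=> t t0.
(* Then lam >= K implies all lower bounds on [lam] in [edges_upper] for m = 2 t. *)
pose K := (8 * t + s + J + 4)%:R : R.
exists (K ^+ J.+1) => n n0.
rewrite /extremal; apply: (big_ind (fun m => m%:R <= K ^+ J.+1 * n%:R `^ (3 - 1 / (s%:R - 1) - 1 / J%:R))).
- by rewrite mulr_ge0 ?powR_ge0 // exprn_ge0.
- by move=> x y hx hy; rewrite /maxn; case: ifP.
move=> G /andP [Gunif Gfree].
pose lam : R := n%:R `^ (1%:R / J%:R).
pose D0 : R := n%:R `^ ((s - 2)%:R / s.-1%:R).
have nR : 0 < n%:R :> R by rewrite ltr0n.
have nneq0 : n%:R != 0 :> R by rewrite gt_eqF.
have n1 : 1 <= n%:R :> R by rewrite ler1n.
have s10 : (0 < s.-1)%N by rewrite -ltnS prednK.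
have lam0 : 0 < lam by apply: powR_gt0.
have D00 : 0 < D0 by apply: powR_gt0.
have lamJ : lam ^+ J = n%:R by rewrite powR_root ?ler0n.
have D0s : D0 ^+ s.-1 = n%:R ^+ (s - 2) by rewrite powR_root ?ler0n.
have nexp : n%:R `^ (3 - 1 / (s%:R - 1) - 1 / J%:R) = n%:R ^+ 2 * D0 / lam.
  rewrite -powR_mulrn ?ler0n // /D0 /lam -powRD; last by rewrite nneq0 implybT.
  rewrite -powRB; last by rewrite nneq0 implybT.
  congr (_ `^ _); rewrite natrB // -subn1 natrB //.
  have : s%:R - 1 != 0 :> R by rewrite subr_eq0 pnatr_eq1 gtn_eqF.
  have : J%:R != 0 :> R by rewrite pnatr_eq0 -lt0n.
  by move=> h1 h2; field; rewrite h1 h2.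
rewrite nexp.
have K1 : 1 <= K by rewrite ler1n addn4.
have hG : #|G|%:R <= edges R (triple G) by apply: card_le_edges.
apply: (le_trans hG).
have lamge1 : 1 <= lam by rewrite -(@ler_pXn2r _ J) ?nnegrE ?powR_ge0 // expr1n lamJ.
have D0ge1 : 1 <= D0.
  by rewrite -(@ler_pXn2r _ s.-1) ?nnegrE ?powR_ge0 // expr1n D0s exprn_ege1.
(* For small n the trivial bound n^3 suffices, because n * lam = lam^(J+1) <= K^(J+1) and D0 >=
   1. *)
have [hlam|hlam] := leP K lam; last first.
  have h3 : edges R (triple G) <= n%:R ^+ 2 * n%:R.
    have := @edges_le R 'I_n n%:R (triple G); rewrite card_ord; apply.
    have h (P : pred 'I_n) : \sum_w (P w)%:R <= n%:R :> R.
      by rewrite sum_indicator ler_nat -[leqRHS](card_ord n) max_card.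
    by move=> u v; split; apply: h.
  apply: (le_trans h3); rewrite mulrA ler_pdivlMr // [leRHS]mulrCA -[leLHS]mulrA.
  apply: ler_wpM2l; first exact: exprn_ge0.
  rewrite -lamJ -exprSr; apply: (@le_trans _ _ (K ^+ J.+1)).
    by apply: lerXn2r; rewrite ?nnegrE ?powR_ge0 //; lra.
  by rewrite ler_peMr // exprn_ge0 //; lra.
have [T [Tt Tc]] := free_covers s0 Gfree.
have KK : K = 8 * t%:R + s%:R + J%:R + 4 by rewrite -natrM -!natrD.
have [t0' s0' J0'] : [/\ 0 <= t%:R :> R, 0 <= s%:R :> R & 0 <= J%:R :> R] by [].
have hfin : lam * edges R (triple G) <= n%:R ^+ 2 * D0.
  have := @edges_upper R 'I_n s s0 s1 hs (triple G) (@triple23 _ G) (@triple12 _ G) T (2 * t%:R) D0 lam J.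
  rewrite card_ord; apply => //.
  - by rewrite mulr_ge0.
  - by move=> S; rewrite -natrM ler_nat mul2n.
  - by lra.
  - by lra.
  - by lra.
  - by rewrite lamJ.
  - by rewrite -natr1; lra.
  (* Raised to the power s - 1 and written in powers of [lam], the claim becomes M (s - 1) < 3 M (s
     - 2). *)
  - rewrite -(@ltr_pXn2r _ s.-1) ?nnegrE ?exprn_ge0 ?powR_ge0 // D0s -lamJ -!exprM.
    rewrite ltr_eXn2l; last by lra.
    rewrite -/M (_ : J * (s - 2) = M * (3 * (s - 2)))%N; last by rewrite /J -mulnA mulnCA.
    rewrite ltn_mul2l M0 /=.
    case: (s) hs => [|[|[|u]]] // _; rewrite !subSS subn0 mulnS.
    by rewrite -[u.+3]/(3 + u)%N leq_add2l leq_pmull.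
rewrite mulrA ler_pdivlMr // mulrC; apply: (le_trans hfin).
rewrite ler_peMl ?exprn_ege1 //; by rewrite mulr_ge0 ?exprn_ge0 // ltW.
Qed.
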